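(* Let the radius $\omega>0$ of the covering balls be chosen. Then the distribution $\tilde{\mathbb P}^n$ constructed by the Incremental Covering Algorithm on $\Xi_n$ is close to the empirical distribution $\hat{\mathbb P}^n$ under the Wasserstein metric, i.e. $$d_W(\hat{\mathbb P}^n,\tilde{\mathbb P}^n)\le\omega .$$
   Context: $\Xi_n=\{\xi_1,\dots,\xi_n\}$ are data points in $\mathcal Z\subseteq\mathbb R^m$ with $\Xi_{n}=\Xi_{n-1}\cup\{\xi_n\}$, and $\hat{\mathbb P}^n=\frac1n\sum_{k=1}^n\delta_{\xi_k}$. For distributions $\mathbb Q_1,\mathbb Q_2$ on $\mathcal Z$ with finite first moment, $d_W(\mathbb Q_1,\mathbb Q_2)=\sup_{g}\{\int_{\mathcal Z} g\,d\mathbb Q_1-\int_{\mathcal Z} g\,d\mathbb Q_2\}$, the supremum being over functions $g$ on $\mathcal Z$ that are Lipschitz with constant 1 with respect to $\|\cdot\|$. The ball is $B_\omega(\zeta)=\{y\in\mathbb R^m:\|y-\zeta\|\le\omega\}$, with the same norm $\|\cdot\|$ (the paper's notation for the 1-norm). **Incremental Covering Algorithm.** It maintains a set of centers $\mathcal C_n=\{\zeta_1,\dots,\zeta_p\}\subseteq\Xi_n$ and weights $\mathcal Q_n=\{\theta_1,\dots,\theta_p\}$, starting from $\mathcal C_0=\mathcal Q_0=\emptyset$. In period $n$, initialize $\mathcal C_n:=\mathcal C_{n-1}$, $\mathcal Q_n:=\mathcal Q_{n-1}$ and process each new data point $\varsigma\in\Xi_n\setminus\Xi_{n-1}$: if $\varsigma\notin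 B_\omega(\zeta_k)$ for all current centers, add the center $\zeta_{p+1}:=\varsigma$ with weight $\theta_{p+1}:=1$ and update $p\leftarrow|\mathcal C_n|$; otherwise let $I_\varsigma\subseteq\{1,\dots,p\}$ be the index set of balls containing $\varsigma$, $\ell_\varsigma=|I_\varsigma|$, and update $\theta_k\leftarrow\theta_k+\ell_\varsigma^{-1}$ for all $k\in I_\varsigma$. The resulting distribution is $\tilde{\mathbb P}^n:=\frac1n\sum_{k=1}^p\theta_k\delta_{\zeta_k}$. *)

(* Defs.v *)
From HB Require Import structures.
From mathcomp Require Export all_boot all_order all_algebra.
From mathcomp Require Export all_classical all_reals all_analysis.
Export Order.TTheory GRing.Theory Num.Theory.
Export numFieldNormedType.Exports.

Set Implicit Arguments.
Unset Strict Implicit.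
Unset Printing Implicit Defensive.

Local Open Scope classical_set_scope.
Local Open Scope ring_scope.

(* The norm that MathComp-Analysis puts on ['rV[R]_m] is the sup norm, hence
   this separate definition of the 1-norm. *)
Definition norm1 (R : realType) (m : nat) (x : 'rV[R]_m) : R :=
  \sum_(i < m) `|x ord0 i|.

Definition in_ball1 (R : realType) (m : nat) (omega : R) (zeta : 'rV[R]_m) :
    pred 'rV[R]_m :=
  fun y => norm1 (y - zeta) <= omega.

(* [Z] with its subspace topology.  Measurable types of the library are pointed;
   [z0] only serves to provide that point. *)
Definition pointed_subset (R : realType) (m : nat) (Z : set 'rV[R]_m) (z0 : Z)
  : Type := set_type Z.

HB.instance Definition _ (R : realType) (m : nat) (Z : set 'rV[R]_m) (z0 : Z) :=
  Topological.on (pointed_subset z0).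
HB.instance Definition _ (R : realType) (m : nat) (Z : set 'rV[R]_m) (z0 : Z) :=
  isPointed.Build (pointed_subset z0) z0.

(* [Z] with its Borel sigma-algebra.  The topology of ['rV[R]_m] is the usual
   one of R^m, which is also that of the 1-norm. *)
Definition borel_subset (R : realType) (m : nat) (Z : set 'rV[R]_m) (z0 : Z) :=
  g_sigma_algebraType (@open (pointed_subset z0)).

Definition lipschitz1 (R : realType) (m : nat) (Z : set 'rV[R]_m) :
    set (Z -> R) :=
  [set g | forall x y : Z, `|g x - g y| <= norm1 (val x - val y)].

(* Meant for distributions with a finite first moment: the two integrals are
   then finite for every [g], and the subtraction in [\bar R] is the genuine
   one. *)
Definition wasserstein (R : realType) (m : nat) (Z : set 'rV[R]_m) (z0 : Z)
    (Q1 Q2 : {measure set (borel_subset z0) -> \bar R}) : \bar R :=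
  ereal_sup [set (\int[Q1]_x (g x)%:E - \int[Q2]_x (g x)%:E)%E
            | g in @lipschitz1 R m Z].

(* The data stream is 0-indexed: the points of period [n] are
   [xi 0, ..., xi (n - 1)].  Repetitions are allowed: a repeated point counts
   again here, and is processed again by the covering algorithm. *)
Definition empirical (R : realType) (m : nat) (Z : set 'rV[R]_m)
    (xi : nat -> Z) (n : nat) :
    {measure set (borel_subset (xi 0%N)) -> \bar R} :=
  mscale (n%:R^-1)%:nng
    (msum (fun k => dirac (xi k : borel_subset (xi 0%N))) n).

(* A state lists the pairs (center, weight) in order of creation. *)
Definition covering_state (R : realType) (m : nat) (Z : set 'rV[R]_m) : Type :=
  seq (Z * {nonneg R}).

Definition covering_step (R : realType) (m : nat) (Z : set 'rV[R]_m) (omega : R)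
    (s : covering_state Z) (x : Z) : covering_state Z :=
  let covers (c : Z * {nonneg R}) := in_ball1 omega (val c.1) (val x) in
  if has covers s then
    let l := count covers s in
    [seq if covers c then (c.1, (c.2%:num + l%:R^-1)%:nng) else c | c <- s]
  else rcons s (x, 1%:nng).

Fixpoint incremental_covering (R : realType) (m : nat) (Z : set 'rV[R]_m)
    (omega : R) (xi : nat -> Z) (n : nat) : covering_state Z :=
  if n is n'.+1 then
    covering_step omega (incremental_covering omega xi n') (xi n')
  else [::].

Definition covering_distribution (R : realType) (m : nat) (Z : set 'rV[R]_m)
    (omega : R) (xi : nat -> Z) (n : nat) :
    {measure set (borel_subset (xi 0%N)) -> \bar R} :=
  let s := incremental_covering omega xi n in
  let c k := nth (xi 0%N, 0%:nng) s k in
  mscale (n%:R^-1)%:nng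
    (msum (fun k =>
       mscale (c k).2 (dirac ((c k).1 : borel_subset (xi 0%N)))) (size s)).

(* Main.v *)
(** The mass of a data point that lies in [l] balls is split equally among their
    centers, each at distance at most [omega], and a new center receives the mass
    of its own data point.  So for a 1-Lipschitz [g], processing a point [x]
    raises the weighted sum of [g] over the centers by at least [g x - omega];
    summing over the [n] points and dividing by [n] bounds the difference of the
    two integrals by [omega]. *)
Require Import Defs.
From mathcomp Require Import all_boot all_order all_algebra.
From mathcomp Require Import all_classical all_reals all_analysis.
From mathcomp Require Import measurable_realfun lra.

Local Open Scope classical_set_scope.
Local Open Scope ring_scope.

Section measure_combinations.
Local Open Scope ereal_scope.
Context {d : measure_display} {T : measurableType d} {R : realType}.
Variables (D : set T) (mD : measurable D).

(** Positive and negative parts are scaled separately. Integrability makes the integral of the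
    positive part finite, so multiplication by [k] distributes over the difference in [\bar R]. *)
Lemma integral_mscale (k : {nonneg R}) (mu : {measure set T -> \bar R})
    (f : T -> \bar R) :
  mu.-integrable D f ->
  \int[mscale k mu]_(x in D) f x = k%:num%:E * \int[mu]_(x in D) f x.
Proof.
move=> intf; have mf := measurable_int _ intf.
rewrite [LHS]integralE [in RHS]integralE !ge0_integral_mscale//.
- by rewrite -muleBr// fin_num_adde_defr// integrable_pos_fin_num.
- exact: measurable_funeneg.
- exact: measurable_funepos.
Qed.

Lemma integrable_mscale (k : {nonneg R}) (mu : {measure set T -> \bar R})
    (f : T -> \bar R) :
  mu.-integrable D f -> (mscale k mu).-integrable D f.
Proof.
move=> /integrableP[mf foo]; apply/integrableP; split => //.
rewrite ge0_integral_mscale//; first exact: lte_mul_pinfty.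
exact: measurableT_comp.
Qed.

Lemma integral_msum (m_ : {measure set T -> \bar R}^nat) (N : nat)
    (f : T -> \bar R) :
  measurable_fun D f -> (forall n, (m_ n).-integrable D f) ->
  \int[msum m_ N]_(x in D) f x = \sum_(n < N) \int[m_ n]_(x in D) f x.
Proof.
move=> mf intf; rewrite [LHS]integralE !ge0_integral_measure_sum//.
(* The negative parts have finite integrals, so the minus sign may enter their sum. *)
- rewrite -fin_num_sumeN; last by move=> i _; exact: integrable_neg_fin_num.
  by rewrite -big_split; apply: eq_bigr => i _ /=; rewrite [RHS]integralE.
- exact: measurable_funeneg.
- exact: measurable_funepos.
Qed.

Lemma integrable_msum (m_ : {measure set T -> \bar R}^nat) (N : nat)
    (f : T -> \bar R) :
  measurable_fun D f -> (forall n, (m_ n).-integrable D f) ->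
  (msum m_ N).-integrable D f.
Proof.
move=> mf intf; apply/integrableP; split => //.
rewrite ge0_integral_measure_sum//; last exact: measurableT_comp.
by apply: lte_sum_pinfty => i _; have /integrableP[] := intf i.
Qed.

Lemma integrable_dirac (a : T) (f : T -> R) :
  measurable_fun D f ->
  (\d_a : {measure set T -> \bar R}).-integrable D (EFin \o f).
Proof.
move=> mf; apply/integrableP; split; first exact/measurable_EFinP.
rewrite integral_dirac//.
  by rewrite diracE /= -EFinM ltry.
by apply: measurableT_comp => //; exact/measurable_EFinP.
Qed.

End measure_combinations.

Section lipschitz_measurable.
Context {R : realType} {m : nat} {Z : set 'rV[R]_m}.

Lemma continuous_norm1B (u : 'rV[R]_m) :
  continuous (fun v : 'rV[R]_m => norm1 (u - v)).
Proof.
rewrite (_ : (fun v => _) =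
    (fun v : 'rV[R]_m => \sum_(i < m) `|u ord0 i - v ord0 i|)); last first.
  by apply/funext => v; apply: eq_bigr => i _; rewrite !mxE.
apply: continuous_big => [|i _ v].
  by move=> v; apply: cvgD; [exact: cvg_fst|exact: cvg_snd].
pose dist_to (r : R) := `|u ord0 i - r|.
apply: (cvg_comp _ dist_to (@coord_continuous R _ _ ord0 i v)).
by apply: cvg_norm; apply: cvgB; [exact: cvg_cst|exact: cvg_id].
Qed.

(** The Lipschitz bound uses the 1-norm while the topology comes from the sup norm. Continuity of
    [norm1] and of [val] bridges the two: the bound tends to 0 as [y] tends to [x]. *)
Lemma lipschitz1_continuous (g : Z -> R) : lipschitz1 g -> continuous g.
Proof.
move=> lg x; have fx : Filter (nbhs x) by exact: nbhs_filter.
apply/cvgrPdist_lt => e e0.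
have cvx : norm1 (val x - val y) @[y --> x] --> norm1 (val x - val x).
  exact: cvg_comp (@initial_continuous Z _ val x) (@continuous_norm1B _ _).
have norm1xx : norm1 (val x - val x) = 0.
  by rewrite subrr /norm1 big1// => i _; rewrite mxE normr0.
rewrite norm1xx in cvx.
move/cvgrPdist_lt : cvx => /(_ e e0); apply: filterS => y.
rewrite sub0r normrN => /(le_lt_trans (ler_norm _)).
exact: le_lt_trans (lg x y).
Qed.

(** Open intervals generate the Borel sets of the line, and by continuity their preimages are open
    in [Z], hence among the generators of its sigma-algebra. *)
Lemma lipschitz1_measurable (z0 : Z) (g : Z -> R) :
  lipschitz1 g -> measurable_fun setT (g : borel_subset z0 -> R).
Proof.
move=> /lipschitz1_continuous/continuousP cg.
apply: (measurability _ (RGenOpens.measurableE R)).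
move=> _ [_ [a [b ->] <-]]; rewrite setTI; apply: sub_sigma_algebra.
exact/cg/interval_open.
Qed.

End lipschitz_measurable.

Section covering.
Context {R : realType} {m : nat} {Z : set 'rV[R]_m}.
Implicit Types (xi : nat -> Z) (g : Z -> R).

Lemma integral_empirical xi (n : nat) g : lipschitz1 g ->
  (\int[empirical xi n]_x (g x)%:E)%E = (n%:R^-1 * \sum_(k < n) g (xi k))%:E.
Proof.
move=> /(@lipschitz1_measurable _ _ _ (xi 0%N)) mg.
have intd k := integrable_dirac _ measurableT
  (xi k : borel_subset (xi 0%N)) _ mg.
have mEg : measurable_fun setT (EFin \o (g : borel_subset (xi 0%N) -> R)).
  exact/measurable_EFinP.
rewrite integral_mscale//; last exact: integrable_msum.
rewrite integral_msum// EFinM -sumEFin; congr (_ * _)%E.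
by apply: eq_bigr => k _; rewrite integral_dirac// diracT mul1e.
Qed.

Lemma integral_covering_distribution (omega : R) xi (n : nat) g :
  lipschitz1 g ->
  (\int[covering_distribution omega xi n]_x (g x)%:E)%E =
  (n%:R^-1 *
   \sum_(c <- incremental_covering omega xi n) c.2%:num * g c.1)%:E.
Proof.
move=> /(@lipschitz1_measurable _ _ _ (xi 0%N)) mg.
have intd (z : borel_subset (xi 0%N)) :=
  integrable_dirac _ measurableT z _ mg.
have mEg : measurable_fun setT (EFin \o (g : borel_subset (xi 0%N) -> R)).
  exact/measurable_EFinP.
have intc (w : {nonneg R}) z := integrable_mscale _ measurableT w _ _ (intd z).
rewrite integral_mscale//; last first.
  by apply: integrable_msum => // k; exact: intc.
rewrite integral_msum//; last by move=> k; exact: intc.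
(* The default pair must be the one used in [covering_distribution]; indices stay below the size, so
   it is never read. *)
rewrite EFinM (big_nth (xi 0%N, 0%:nng)) big_mkord -sumEFin.
congr (_ * _)%E; apply: eq_bigr => k _.
by rewrite integral_mscale// integral_dirac// diracT mul1e EFinM.
Qed.

Lemma covering_step_ge (omega : R) (s : covering_state Z) (x : Z) g :
  0 < omega -> lipschitz1 g ->
  \sum_(c <- s) c.2%:num * g c.1 + (g x - omega) <=
  \sum_(c <- covering_step omega s x) c.2%:num * g c.1.
Proof.
move=> omega0 lg; rewrite /covering_step.
set covers := fun c : Z * {nonneg R} => in_ball1 omega (val c.1) (val x).
case: ifPn => [|_]; last first.
  (* With a new center of weight 1 the sum grows by exactly [g x]. *)
  by rewrite -cats1 big_cat big_seq1/= mul1r lerD2l gerBl ltW.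
rewrite has_count; set l := count covers s => l0; rewrite big_map.
rewrite [leRHS](_ : _ = \sum_(c <- s) c.2%:num * g c.1 +
                        \sum_(c <- s | covers c) l%:R^-1 * g c.1); last first.
  rewrite [X in _ + X]big_mkcond -big_split; apply: eq_bigr => c _ /=.
  by rewrite /covers/=; case: ifPn => _; rewrite ?addr0//= mulrDl.
rewrite lerD2l.
(* The bound is cut into [l] equal shares, one per covering ball, to be compared term by term; [l0]
   allows the division. *)
have -> : g x - omega = \sum_(c <- s | covers c) l%:R^-1 * (g x - omega).
  rewrite big_const_seq iter_addr_0 -/l -mulrnAl -mulr_natr mulVf ?mul1r//.
  by rewrite pnatr_eq0 -lt0n.
apply: ler_sum => c cx; rewrite ler_wpM2l ?invr_ge0//.
(* Here [cx] is the ball membership: [g x - g c.1] is at most the 1-norm distance from [x] to the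
   center, hence at most [omega]. *)
rewrite lerBlDr -lerBlDl; apply: le_trans (ler_norm _) _.
exact: le_trans (lg _ _) cx.
Qed.

Lemma incremental_covering_ge (omega : R) xi (n : nat) g :
  0 < omega -> lipschitz1 g ->
  \sum_(k < n) g (xi k) - \sum_(c <- incremental_covering omega xi n)
    c.2%:num * g c.1 <= n%:R * omega.
Proof.
move=> omega0 lg; elim: n => [|n IHn].
  by rewrite big_ord0 big_nil subrr mul0r.
have := covering_step_ge _ (incremental_covering omega xi n) (xi n) _ omega0 lg.
by rewrite big_ord_recr -natr1 mulrDl mul1r /=; lra.
Qed.

End covering.

Theorem mainTheorem3 (R : realType) (m : nat) (Z : set 'rV[R]_m)
    (xi : nat -> Z) (n : nat) (omega : R) :
  (0 < n)%N -> 0 < omega ->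
  (wasserstein (empirical xi n) (covering_distribution omega xi n)
     <= omega%:E)%E.
Proof.
(* The supremum runs over signed differences, so a one-sided estimate for each [g] suffices. *)
move=> n0 omega0; apply: ge_ereal_sup => _ [g lg <-].
rewrite integral_empirical// integral_covering_distribution// -EFinB lee_fin.
rewrite -mulrBr ler_pdivrMl ?ltr0n//.
exact: incremental_covering_ge.
Qed.
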